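(* Let $A_1$ and $A_2$ be (complex) unitary matrices and $M_1:=\max_{i,j}|A_1(ij)|$, $M_2:=\max_{i,j}|A_2(ij)|$. Then $$\frac1{M_1^2M_2^2}\le\mu(A_1\otimes A_2)\le\mu(A_1)\cdot\mu(A_2).$$ In particular, if $A$ is a unitary matrix and $M:=\max_{i,j}|A(ij)|$, then for every integer $p\ge1$, $$\frac1{M^p}\le\mu(A^{\otimes p})\le\mu(A)^p.$$ If $A$ is an $N\times N$ matrix such that $\sqrt N A$ is a Hadamard matrix, then, for every integer $p\ge1$, $$\mu(A^{\otimes p})=N^p.$$
   Context: For an $n\times n$ unitary matrix $A$, the uncertainty constant of $A$ is $\mu(A):=\min_{f\in\mathbb C^n\setminus\{0\}}|\mathrm{supp}(f)|\cdot|\mathrm{supp}(Af)|$, where $\mathrm{supp}(f)=\{k:f(k)\ne0\}$ and $|\cdot|$ of a set is its cardinality. A Hadamard matrix is a square matrix with all entries (possibly complex) of absolute value one and mutually orthogonal rows/columns; thus if $\sqrt NA$ is an $N\times N$ Hadamard matrix then $A$ is unitary. Tensor product convention (indices from $0$): for $A$ of size $N\times N$ and $B$ of size $M\times M$, $(A\otimes B)_{i_1+Ni_2,\,j_1+Nj_2}=A_{i_1j_1}B_{i_2j_2}$ for $0\le i_1,j_1\le N-1$, $0\le i_2,j_2\le M-1$. $A^{\otimes1}=A$, $A^{\otimes n}=A\otimes A^{\otimes(n-1)}$. *)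

(* Defs.v *)
From mathcomp Require Import all_boot all_order all_algebra.
From mathcomp Require Import complex mxtens.
From mathcomp Require Import boolp reals.
Set Implicit Arguments.
Unset Strict Implicit.
Unset Printing Implicit Defensive.
Import Order.TTheory GRing.Theory Num.Theory.
Import ComplexField.Normc.
Local Open Scope ring_scope.
Local Open Scope complex_scope.

Section Defs.
Variable R : realType.
Local Notation C := R[i].

Definition supp n (f : 'cV[C]_n) : {set 'I_n} := [set k | f k 0 != 0].

Definition uncertainty_value n (A : 'M[C]_n) (k : nat) : Prop :=
  exists f : 'cV[C]_n, f != 0 /\ k = (#|supp f| * #|supp (A *m f)|)%N.

(* The minimum of the values above; the junk value 0 is taken only for n = 0,
   when there is no nonzero f (see [muP]). *)
Definition mu n (A : 'M[C]_n) : nat :=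
  if pselect (exists k, `[< uncertainty_value A k >]) is left ex
  then ex_minn ex else 0%N.

Lemma muP n (A : 'M[C]_n) : (0 < n)%N ->
  (exists f : 'cV[C]_n,
     f != 0 /\ mu A = (#|supp f| * #|supp (A *m f)|)%N) /\
  (forall f : 'cV[C]_n, f != 0 ->
     (mu A <= #|supp f| * #|supp (A *m f)|)%N).
Proof.
move=> n0; rewrite /mu; case: pselect => [ex|[]].
  case: ex_minnP => k /asboolP vk le; split=> // f f0.
  by apply: le; apply/asboolP; exists f.
pose f : 'cV[C]_n := const_mx 1.
exists (#|supp f| * #|supp (A *m f)|)%N; apply/asboolP; exists f; split=> //.
by apply/eqP => /matrixP /(_ (Ordinal n0) 0) /eqP; rewrite !mxE oner_eq0.
Qed.

(* All moduli are nonnegative, so starting the maximum at 0 is harmless. *)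
Definition max_entry n (A : 'M[C]_n) : R :=
  \big[Num.max/0]_(i < n) \big[Num.max/0]_(j < n) normc (A i j).

Definition hadamard n (H : 'M[C]_n) : Prop :=
  (forall i j, normc (H i j) = 1) /\
  (forall i k, i != k -> \sum_(j < n) H i j * (H k j)^* = 0).

(* Here the index (i1, i2) is encoded as i1 + N * i2, whereas [tensmx] encodes
   a pair (i, j) with j varying fastest; hence the swap of the factors. *)
Definition kron N M (A : 'M[C]_N) (B : 'M[C]_M) : 'M[C]_(N * M) :=
  castmx (mulnC M N, mulnC M N) (B *t A).

Lemma kronE N M (A : 'M[C]_N) (B : 'M[C]_M)
    (i j : 'I_(N * M)) (i1 j1 : 'I_N) (i2 j2 : 'I_M) :
  i = (i1 + N * i2)%N :> nat -> j = (j1 + N * j2)%N :> nat ->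
  kron A B i j = A i1 j1 * B i2 j2.
Proof.
move=> ei ej; rewrite castmxE [RHS]mulrC -tensmxE.
by congr (_ _ _); apply: val_inj => /=; rewrite ?ei ?ej addnC mulnC.
Qed.

Fixpoint kron_pow_rec N (A : 'M[C]_N) (k : nat) : 'M[C]_(N ^ k.+1) :=
  if k is k'.+1 then kron A (kron_pow_rec A k') else A.

Definition kron_pow N (A : 'M[C]_N) (p : nat) : 'M[C]_(N ^ p) :=
  if p is p'.+1 return 'M[C]_(N ^ p) then kron_pow_rec A p' else 1%:M.

Lemma kron_pow1 N (A : 'M[C]_N) : kron_pow A 1 = A.
Proof. by []. Qed.

Lemma kron_powSS N (A : 'M[C]_N) p :
  kron_pow A p.+2 = kron A (kron_pow A p.+1).
Proof. by []. Qed.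

End Defs.

(* Main.v *)
(* If g = A f with A unitary and M bounds the moduli of its entries, then
   |g_i| <= M |f|_1, so by Cauchy-Schwarz
   |f|_2^2 = |g|_2^2 <= |supp g| M^2 |f|_1^2 <= |supp g| M^2 |supp f| |f|_2^2,
   hence mu(A) >= 1 / M^2.  Kronecker products are unitary and their entries
   are products of entries, which gives the lower bounds.  The upper bounds
   come from tensoring minimizers, whose supports multiply.  In the Hadamard
   case M^2 = 1 / N, and a point mass attains the lower bound. *)
Require Import Defs.
From mathcomp Require Import all_boot all_order all_algebra.
From mathcomp Require Import complex mxtens spectral.
From mathcomp Require Import boolp reals.
Set Implicit Arguments.
Unset Strict Implicit.
Unset Printing Implicit Defensive.
Import Order.TTheory GRing.Theory Num.Theory.
Local Open Scope ring_scope.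
Local Open Scope complex_scope.

Local Notation normc := ComplexField.Normc.normc.

(** * Cauchy-Schwarz and unitary matrices *)

(** Cauchy-Schwarz against the constant 1: twice the difference of the two sides is the sum of
    [(x i - x j) ^+ 2] over all pairs in [S]. *)
Lemma sqr_sum_le_card (F : numDomainType) (I : finType) (S : {set I})
    (x : I -> F) :
  (forall i, x i \is Num.real) ->
  (\sum_(i in S) x i) ^+ 2 <= #|S|%:R * \sum_(i in S) x i ^+ 2.
Proof.
move=> xr; rewrite -(@ler_pMn2r _ 2)//.
have -> : (#|S|%:R * \sum_(i in S) x i ^+ 2) *+ 2 =
          \sum_(i in S) \sum_(j in S) (x i ^+ 2 + x j ^+ 2).
  under [RHS]eq_bigr => i _ do rewrite big_split/= sumr_const.
  by rewrite big_split/= sumr_const sumrMnl mulr_natl mulr2n.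
rewrite expr2 big_distrlr/= -sumrMnl; apply: ler_sum => i _.
rewrite -sumrMnl; apply: ler_sum => j _; rewrite -subr_ge0.
have -> : x i ^+ 2 + x j ^+ 2 - x i * x j *+ 2 = (x i - x j) ^+ 2.
  by rewrite sqrrB addrAC.
by rewrite real_exprn_even_ge0 ?rpredB.
Qed.

Lemma unitarymx_isometry (F : numClosedFieldType) n (A : 'M[F]_n)
    (f : 'cV[F]_n) : A \is unitarymx ->
  \sum_i `|(A *m f) i 0| ^+ 2 = \sum_i `|f i 0| ^+ 2.
Proof.
(* [unitarymxP] puts the adjoint on the right of [A]; the norm of [A *m f] needs it on the left. *)
move=> /unitarymxP /mulmx1C AA.
have nE (g : 'cV[F]_n) :
    \sum_i `|g i 0| ^+ 2 = ((g ^t Num.conj)%sesqui *m g) 0 0.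
  by rewrite mxE; apply: eq_bigr => i _; rewrite !mxE normCK mulrC.
by rewrite !nE trmx_mul map_mxM mulmxA -(mulmxA _ _ A) AA mulmx1.
Qed.

(** Each row has Euclidean norm 1, and the squared modulus of an entry is one term of that sum. *)
Lemma unitarymx_entry_le1 (F : numClosedFieldType) n (A : 'M[F]_n) i j :
  A \is unitarymx -> `|A i j| <= 1.
Proof.
move=> /unitarymxP /matrixP /(_ i i); rewrite !mxE eqxx => AA.
rewrite -(@expr_le1 _ 2)// -[leRHS]AA (bigD1 j)//= !mxE -normCK lerDl.
by apply: sumr_ge0 => k _; rewrite !mxE -normCK exprn_ge0.
Qed.

Section Mu.
Variable R : realType.
Local Notation C := R[i].

(** * Supports, largest entry and the lower bound *)

Lemma normc_ge0 (x : C) : 0 <= normc x.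
Proof. by case: x => a b; rewrite /ComplexField.Normc.normc sqrtr_ge0. Qed.

Lemma notin_supp n (f : 'cV[C]_n) k : k \notin supp f -> f k 0 = 0.
Proof. by rewrite inE negbK => /eqP. Qed.

Lemma supp_eq0 n (f : 'cV[C]_n) : (#|supp f| == 0)%N = (f == 0).
Proof.
rewrite cards_eq0; apply/eqP/eqP => [f0|->]; last first.
  by apply/setP => k; rewrite !inE mxE eqxx.
by apply/matrixP => k j; rewrite ord1 mxE notin_supp// f0 inE.
Qed.

Lemma supp_prod_ge n (A : 'M[C]_n) (f : 'cV[C]_n) (m : C) :
  A \is unitarymx -> (forall i j, `|A i j| <= m) -> f != 0 ->
  1 <= m ^+ 2 * (#|supp f| * #|supp (A *m f)|)%:R.
Proof.
move=> Au Am f0; set g := A *m f.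
pose s2 := \sum_i `|f i 0| ^+ 2; pose s1 := \sum_(i in supp f) `|f i 0|.
have suppE (h : 'cV[C]_n) :
    \sum_i `|h i 0| ^+ 2 = \sum_(i in supp h) `|h i 0| ^+ 2.
  rewrite [RHS]big_mkcond; apply: eq_bigr => i _.
  by case: ifPn => // /notin_supp ->; rewrite normr0 expr0n.
have s2_gt0 : 0 < s2.
  rewrite lt_def sumr_ge0 ?andbT; last by move=> i _; rewrite exprn_ge0.
  apply: contra f0; rewrite psumr_eq0 => [/allP f0|i _]; last first.
    by rewrite exprn_ge0.
  apply/eqP/matrixP => i j; rewrite ord1 mxE; apply/eqP.
  by have := f0 i (mem_index_enum _); rewrite expf_eq0 normr_eq0.
have gi i : `|g i 0| <= m * s1.
  rewrite mxE (le_trans (ler_norm_sum _ _ _))// mulr_sumr [leRHS]big_mkcond.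
  apply: ler_sum => j _; rewrite normrM; case: ifPn => [_|/notin_supp ->].
    exact: ler_wpM2r.
  by rewrite normr0 mulr0.
(* That [m] is nonnegative comes from its bounding an entry of [A]; since [f] is nonzero, there is
   an index [k] to take one at. *)
have m2_ge0 : 0 <= m ^+ 2.
  have /set0Pn[k _] : supp f != set0 by rewrite -cards_eq0 supp_eq0.
  by rewrite exprn_ge0// (le_trans _ (Am k k)).
(* The claim multiplied by [s2], which is positive and is cancelled at the end. *)
have : s2 <= m ^+ 2 * (#|supp f| * #|supp g|)%:R * s2.
  rewrite {1}/s2 -(unitarymx_isometry f Au) suppE.
  apply: (@le_trans _ _ (\sum_(i in supp g) (m * s1) ^+ 2)).
    by apply: ler_sum => i _; rewrite lerXn2r ?nnegrE// (le_trans _ (gi i)).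
  rewrite sumr_const -[leLHS]mulr_natr exprMn natrM.
  rewrite -(mulrA (m ^+ 2)) -(mulrA (m ^+ 2)) ler_wpM2l//.
  rewrite mulrC mulrAC [leRHS]mulrC ler_wpM2l// /s2 suppE.
  by apply: sqr_sum_le_card => i; rewrite normr_real.
by rewrite -[leLHS]mul1r ler_pM2r.
Qed.

Lemma max_entry_ge n (A : 'M[C]_n) i j : normc (A i j) <= max_entry A.
Proof.
apply: (@le_trans _ _ (\big[Num.max/0]_(j < n) normc (A i j))).
  exact: (le_bigmax _ (fun j => normc (A i j))).
exact: (le_bigmax _ (fun i => \big[Num.max/0]_(j < n) normc (A i j))).
Qed.

Lemma max_entry_le n (A : 'M[C]_n) (m : R) : 0 <= m ->
  (forall i j, normc (A i j) <= m) -> max_entry A <= m.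
Proof. by move=> m0 Am; do 2!apply: bigmax_le => // ? _. Qed.

Lemma max_entry_ge0 n (A : 'M[C]_n) : 0 <= max_entry A.
Proof.
case: n A => [|n] A; first by rewrite /max_entry big_ord0.
exact: le_trans (normc_ge0 _) (max_entry_ge A ord0 ord0).
Qed.

Lemma unitarymx_max_entry_le1 n (A : 'M[C]_n) :
  A \is unitarymx -> max_entry A <= 1.
Proof.
move=> Au; apply: max_entry_le => // i j.
by rewrite -lecR; exact: unitarymx_entry_le1.
Qed.

(** Any upper bound [m] is allowed, so that tensor products can use products of maxima. The form
    without a quotient also shows that [m] is nonzero. *)
Lemma mu_ge n (A : 'M[C]_n) (m : R) : (0 < n)%N -> A \is unitarymx ->
  max_entry A <= m -> 1 <= m ^+ 2 * (mu A)%:R.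
Proof.
move=> n0 Au Am; have [[f [f0 ->]] _] := muP A n0.
have h i j : `|A i j| <= m%:C.
  by rewrite -lecR in Am *; apply: le_trans Am; rewrite lecR max_entry_ge.
have := supp_prod_ge Au h f0.
by rewrite -rmorphXn -(rmorph_nat (real_complex R)) -rmorphM lecR.
Qed.

Lemma inv_le_mu n (A : 'M[C]_n) (m : R) : (0 < n)%N -> A \is unitarymx ->
  max_entry A <= m -> 1 / m ^+ 2 <= (mu A)%:R.
Proof.
move=> n0 Au Am; have k := mu_ge n0 Au Am.
(* For [m = 0] the quotient is 0, as the inverse of 0 is 0. *)
have [->|m0] := eqVneq m 0; first by rewrite expr0n invr0 mulr0.
by rewrite ler_pdivrMr 1?mulrC// exprn_even_gt0.
Qed.

(** * Kronecker products *)

Lemma kron_unitary n1 n2 (A1 : 'M[C]_n1) (A2 : 'M[C]_n2) :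
  A1 \is unitarymx -> A2 \is unitarymx -> kron A1 A2 \is unitarymx.
Proof.
move=> /unitarymxP A1u /unitarymxP A2u; apply/unitarymxP.
(* Eliminating the equality of dimensions makes the cast trivial; the mixed-product rule then
   applies. *)
rewrite /kron; case: _ / (mulnC n2 n1); rewrite castmx_id trmx_tens.
have -> : ((A2^T *t A1^T) ^ Num.conj = (A2 ^t Num.conj) *t (A1 ^t Num.conj))%sesqui.
  by apply/matrixP => i j; rewrite !mxE rmorphM.
rewrite tensmx_mul A1u A2u; apply/matrixP => i j.
case: (mxtens_indexP i) => i1 i2; case: (mxtens_indexP j) => j1 j2.
rewrite tensmxE !mxE (can_eq (@mxtens_indexK _ _)) xpair_eqE.
by rewrite -natrM mulnb.
Qed.

Lemma max_entry_kron n1 n2 (A1 : 'M[C]_n1) (A2 : 'M[C]_n2) :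
  max_entry (kron A1 A2) <= max_entry A1 * max_entry A2.
Proof.
apply: max_entry_le => [|i j]; first by rewrite mulr_ge0 ?max_entry_ge0.
rewrite castmxE mxE ComplexField.Normc.normcM mulrC.
by rewrite ler_pM ?normc_ge0 ?max_entry_ge.
Qed.

(* [1 * 1] is convertible to [1], so a tensor product of columns is a column. *)
Lemma card_supp_tens n1 n2 (f1 : 'cV[C]_n1) (f2 : 'cV[C]_n2) :
  #|supp (f1 *t f2 : 'cV_(n1 * n2))| = (#|supp f1| * #|supp f2|)%N.
Proof.
rewrite -cardsX -(card_imset _ (can_inj (@mxtens_indexK n1 n2))).
apply: eq_card => k; case: (mxtens_indexP k) => i j.
rewrite mem_imset ?inE; last exact: can_inj (@mxtens_indexK _ _).
by rewrite !mxE mxtens_indexK !ord1 mulf_eq0 negb_or.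
Qed.

(** The test vector is [f2 *t f1] for minimizers [f1] and [f2], in the swapped order used by [kron];
    its image is the tensor product of the images. *)
Lemma mu_kron n1 n2 (A1 : 'M[C]_n1) (A2 : 'M[C]_n2) :
  (0 < n1)%N -> (0 < n2)%N -> (mu (kron A1 A2) <= mu A1 * mu A2)%N.
Proof.
move=> n1_gt0 n2_gt0; have n12_gt0 : (0 < n2 * n1)%N by rewrite muln_gt0 n2_gt0.
have [[f1 [f1_neq0 ->]] _] := muP A1 n1_gt0.
have [[f2 [f2_neq0 ->]] _] := muP A2 n2_gt0.
rewrite mulnACA /kron; case: _ / (mulnC n2 n1); rewrite castmx_id.
have [_ /(_ (f2 *t f1))] := muP (A2 *t A1) n12_gt0.
rewrite -supp_eq0 card_supp_tens muln_eq0 !supp_eq0 negb_or f1_neq0 f2_neq0.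
move=> /(_ isT) /leq_trans; apply.
have -> : (A2 *t A1) *m (f2 *t f1 : 'cV_(n2 * n1)) = (A2 *m f2) *t (A1 *m f1).
  exact: (@tensmx_mul _ n2 n2 n1 n1 1 1).
by rewrite card_supp_tens (mulnC #|supp f2|) (mulnC #|supp (A2 *m f2)|).
Qed.

(** A point mass has a support of size one, and its image has at most full support. *)
Lemma mu_le_size n (A : 'M[C]_n) : (mu A <= n)%N.
Proof.
case: n A => [|n] A.
  (* In dimension 0 there is no nonzero vector, so [mu] takes its default value 0. *)
  rewrite /mu; case: pselect => // -[k] /asboolP [f [/negP []]].
  by apply/eqP/matrixP => -[].
have [_ /(_ (delta_mx ord0 0))] := muP A (ltn0Sn n).
have -> : supp (delta_mx ord0 0 : 'cV[C]_n.+1) = [set ord0].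
  apply/setP => k; rewrite !inE mxE eqxx andbT.
  by case: (k == ord0); rewrite ?oner_eq0 ?eqxx.
rewrite cards1 mul1n => h; apply: leq_trans (h _) _; last first.
  by rewrite -[leqRHS]card_ord max_card.
by apply/eqP => /matrixP /(_ ord0 0) /eqP; rewrite !mxE eqxx oner_eq0.
Qed.

(** * Tensor powers *)

Lemma kron_pow_unitary n (A : 'M[C]_n) p :
  A \is unitarymx -> kron_pow A p.+1 \is unitarymx.
Proof.
by move=> Au; elim: p => // p IHp; rewrite kron_powSS; exact: kron_unitary.
Qed.

Lemma max_entry_kron_pow n (A : 'M[C]_n) p :
  max_entry (kron_pow A p.+1) <= max_entry A ^+ p.+1.
Proof.
elim: p => // p IHp; rewrite kron_powSS (le_trans (max_entry_kron _ _))//.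
by rewrite exprS ler_wpM2l ?max_entry_ge0.
Qed.

Lemma mu_kron_pow n (A : 'M[C]_n) p :
  (0 < n)%N -> (mu (kron_pow A p.+1) <= mu A ^ p.+1)%N.
Proof.
move=> n0; elim: p => [|p IHp]; first by rewrite [leqRHS]expn1.
have np0 : (0 < n ^ p.+1)%N by rewrite expn_gt0 n0.
rewrite kron_powSS [leqRHS]expnS (leq_trans (mu_kron _ _ n0 np0))//.
exact: leq_mul.
Qed.

(** * Hadamard matrices *)

Lemma hadamard_normc n (A : 'M[C]_n) (c : R) i j :
  0 < c -> hadamard (c%:C *: A) -> normc (A i j) = c^-1.
Proof.
move=> c0 [/(_ i j) + _]; rewrite mxE ComplexField.Normc.normcM.
have -> : normc c%:C = c by rewrite /= expr0n addr0 sqrtr_sqr gtr0_norm.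
by move=> cA; rewrite -[RHS]mulr1 -cA mulKf// gt_eqF.
Qed.

Lemma hadamard_unitary n (A : 'M[C]_n) : (0 < n)%N ->
  hadamard ((Num.sqrt (n%:R : R))%:C *: A) -> A \is unitarymx.
Proof.
move=> n0 hA; have c0 : 0 < Num.sqrt (n%:R : R) by rewrite sqrtr_gt0 ltr0n.
have nz : (n%:R : C) != 0 by rewrite pnatr_eq0 -lt0n.
apply/unitarymxP/matrixP => i k; rewrite !mxE; have [<-|ik] := eqVneq i k.
  rewrite (eq_bigr (fun=> n%:R^-1)) => [|j _].
    by rewrite sumr_const card_ord -[LHS]mulr_natr mulVf ?eqxx.
  rewrite !mxE -normCK.
  have -> : `|A i j| = (normc (A i j))%:C by [].
  rewrite (hadamard_normc _ _ c0 hA) -rmorphXn exprVn sqr_sqrtr ?ler0n//.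
  by rewrite fmorphV rmorph_nat.
(* Off the diagonal, the two scalars [Num.sqrt n%:R] leave the sum as a factor [n], which is nonzero
   and cancels. *)
have [_ /(_ i k ik)] := hA.
under eq_bigr => j _ do rewrite !mxE rmorphM [X in _ * (X * _)]conjc_real mulrACA.
rewrite -mulr_sumr -rmorphM -expr2 sqr_sqrtr ?ler0n// rmorph_nat => /eqP.
rewrite mulf_eq0 (negPf nz) => /eqP /= h; rewrite -[RHS]h.
by apply: eq_bigr => j _; rewrite !mxE.
Qed.

Lemma mu_kron_pow_hadamard n (A : 'M[C]_n) p : (0 < n)%N ->
  hadamard ((Num.sqrt (n%:R : R))%:C *: A) -> mu (kron_pow A p.+1) = (n ^ p.+1)%N.
Proof.
move=> n0 hA; apply/eqP; rewrite eqn_leq mu_le_size/=.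
have c0 : 0 < Num.sqrt (n%:R : R) by rewrite sqrtr_gt0 ltr0n.
have np0 : (0 < n ^ p.+1)%N by rewrite expn_gt0 n0.
have Am : max_entry A <= (Num.sqrt n%:R)^-1.
  apply: max_entry_le => [|i j]; first by rewrite invr_ge0 ltW.
  by rewrite (hadamard_normc _ _ c0 hA).
(* The inverse square of this bound is exactly [n ^ p.+1]. *)
have /(inv_le_mu np0 (kron_pow_unitary p (hadamard_unitary n0 hA))) :
    max_entry (kron_pow A p.+1) <= (Num.sqrt n%:R)^-1 ^+ p.+1.
  apply: le_trans (max_entry_kron_pow _ _) _.
  by rewrite lerXn2r ?nnegrE ?max_entry_ge0 ?invr_ge0 ?sqrtr_ge0.
rewrite exprAC exprVn sqr_sqrtr ?ler0n// exprVn div1r invrK -natrX.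
by rewrite ler_nat.
Qed.

End Mu.

Theorem corollary5p11 (R : realType) :
  (forall (n1 n2 : nat) (A1 : 'M[R[i]]_n1) (A2 : 'M[R[i]]_n2),
     (0 < n1)%N -> (0 < n2)%N ->
     A1 \is unitarymx -> A2 \is unitarymx ->
     1 / (max_entry A1 ^+ 2 * max_entry A2 ^+ 2) <= (mu (kron A1 A2))%:R :> R
     /\ (mu (kron A1 A2) <= mu A1 * mu A2)%N)
  /\
  (forall (n : nat) (A : 'M[R[i]]_n),
     (0 < n)%N -> A \is unitarymx ->
     forall p : nat, (1 <= p)%N ->
     1 / max_entry A ^+ p <= (mu (kron_pow A p))%:R :> R
     /\ (mu (kron_pow A p) <= mu A ^ p)%N)
  /\
  (forall (N : nat) (A : 'M[R[i]]_N),
     (0 < N)%N -> hadamard ((Num.sqrt (N%:R : R))%:C *: A) ->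
     forall p : nat, (1 <= p)%N ->
     mu (kron_pow A p) = (N ^ p)%N).
Proof.
split; [|split] => [n1 n2 A1 A2 n1_gt0 n2_gt0 A1u A2u | n A n0 Au [//|p] _ |
                    n A n0 hA [//|p] _]; last exact: mu_kron_pow_hadamard.
  split; last exact: mu_kron.
  rewrite -exprMn; apply: inv_le_mu (kron_unitary A1u A2u) (max_entry_kron _ _).
  by rewrite muln_gt0 n1_gt0.
split; last exact: mu_kron_pow.
have np0 : (0 < n ^ p.+1)%N by rewrite expn_gt0 n0.
have Apu := kron_pow_unitary p Au; have Am := max_entry_kron_pow A p.
(* The available bound has the square of [max_entry A ^+ p.+1] in the denominator; it is the
   stronger one because [max_entry A <= 1]. *)
apply: le_trans (inv_le_mu np0 Apu Am).
(* If this power vanished, [mu_ge] would read [1 <= 0]. *)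
have M0 : 0 < max_entry A ^+ p.+1.
  rewrite lt_def exprn_ge0 ?max_entry_ge0// andbT; apply/eqP => m0.
  by have := mu_ge np0 Apu Am; rewrite m0 expr0n mul0r ler10.
rewrite !div1r lef_pV2 ?posrE ?(exprn_gt0 _ M0)// [leLHS]expr2 ger_pMr//.
by rewrite exprn_ile1 ?max_entry_ge0 ?unitarymx_max_entry_le1.
Qed.
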